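(* Let $\mathcal{X}$ be a compact subset of a Euclidean space, $k$ a continuous positive definite kernel on $\mathcal{X}$ with $\sup_{x\in\mathcal{X}}k(x,x)\le1$, $\mathcal{H}_k$ its RKHS and $\mathcal{H}_k^1$ the closed unit ball of $\mathcal{H}_k$. Let $\rho$ be a Borel probability measure on $\mathcal{X}$, and let $(\lambda_i)_{i\ge1}$ be the eigenvalues of $(K_\rho g)(x)=\int_{\mathcal{X}}k(x,x')g(x')\,d\rho(x')$ on $L^2(\rho)$, listed in nonincreasing order with multiplicity (padded with zeros if there are finitely many nonzero ones). Let $n\ge1$, $x_1,\dots,x_n\in\mathcal{X}$, and let $\mathcal{G}_n:\mathcal{H}_k^1\to C(\mathcal{X})$ be any map (not necessarily linear) such that $\mathcal{G}_nf=\mathcal{G}_nf'$ whenever $f,f'\in\mathcal{H}_k^1$ satisfy $f(x_i)=f'(x_i)$ for $i=1,\dots,n$. Then: (1) $\displaystyle\sup_{f\in\mathcal{H}_k^1}\|f-\mathcal{G}_nf\|_\infty\ge\Big(\sum_{i=n+1}^\infty\lambda_i\Big)^{1/2}$. (2) If in addition $\mathcal{G}_nf(x)\ge f(x)$ for all $f\in\mathcal{H}_k^1$ and $x\in\mathcal{X}$, then $\displaystyle\sup_{f\in\mathcal{H}_k^1}\mathbb{E}_{x\sim\rho}[\mathcal{G}_nf(x)-f(x)]\ge\sum_{i=n+1}^\infty\lambda_i$.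
   Context: A continuous positive definite kernel $k$ on $\mathcal{X}$ is a continuous symmetric function with $\sum_{i,j}a_ia_jk(x_i,x_j)\ge0$ for all finite families; $\mathcal{H}_k$ is the associated reproducing kernel Hilbert space ($k(x,\cdot)\in\mathcal{H}_k$ and $f(x)=\langle f,k(x,\cdot)\rangle_{\mathcal{H}_k}$). $C(\mathcal{X})$ is the space of bounded continuous functions with sup norm $\|\cdot\|_\infty$. *)

(* Defs.v *)
From HB Require Import structures.
From mathcomp Require Import all_boot all_order all_algebra.
From mathcomp Require Import all_classical all_reals all_analysis.
Set Implicit Arguments. Unset Strict Implicit. Unset Printing Implicit Defensive.
Import Order.TTheory GRing.Theory Num.Theory.
Import numFieldNormedType.Exports.
Local Open Scope classical_set_scope.
Local Open Scope ring_scope.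

Definition BorelE (R : realType) (d : nat) :=
  g_sigma_algebraType (@open 'rV[R]_d).

Definition cont_pd_kernel (R : realType) (d : nat) (X : set 'rV[R]_d)
  (k : 'rV[R]_d -> 'rV[R]_d -> R) : Prop :=
  [/\ {within X `*` X, continuous (fun p => k p.1 p.2)},
      (forall x y, X x -> X y -> k x y = k y x) &
      (forall (m : nat) (xs : 'I_m -> 'rV[R]_d) (a : 'I_m -> R),
         (forall i, X (xs i)) ->
         0 <= \sum_(i < m) \sum_(j < m) a i * a j * k (xs i) (xs j))].

(* functions on X are represented as functions on R^d vanishing outside X;
   ksec X k x is the function k(x,.) on X *)
Definition ksec (R : realType) (d : nat) (X : set 'rV[R]_d)
  (k : 'rV[R]_d -> 'rV[R]_d -> R) (x : 'rV[R]_d) : 'rV[R]_d -> R :=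
  fun y => if `[< X y >] then k x y else 0.

Record is_RKHS (R : realType) (d : nat) (X : set 'rV[R]_d)
  (k : 'rV[R]_d -> 'rV[R]_d -> R) (H : set ('rV[R]_d -> R))
  (ip : ('rV[R]_d -> R) -> ('rV[R]_d -> R) -> R) : Prop := {
  rkhs_supp : forall f, H f -> forall y, ~ X y -> f y = 0;
  rkhs_0 : H (fun _ => 0);
  rkhs_add : forall f g, H f -> H g -> H (fun y => f y + g y);
  rkhs_scale : forall (a : R) f, H f -> H (fun y => a * f y);
  rkhs_sym : forall f g, H f -> H g -> ip f g = ip g f;
  rkhs_lin : forall (a : R) f g h, H f -> H g -> H h ->
     ip (fun y => a * f y + g y) h = a * ip f h + ip g h;
  rkhs_pos : forall f, H f -> 0 <= ip f f;
  rkhs_def : forall f, H f -> ip f f = 0 -> f = (fun _ => 0);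
  rkhs_complete : forall u : nat -> 'rV[R]_d -> R, (forall m, H (u m)) ->
     (forall e : R, 0 < e -> exists N, forall m p, (N <= m)%N -> (N <= p)%N ->
        ip (fun y => u m y - u p y) (fun y => u m y - u p y) < e) ->
     exists f, H f /\
        (fun m => ip (fun y => u m y - f y) (fun y => u m y - f y)) @ \oo --> 0;
  rkhs_ksec : forall x, X x -> H (ksec X k x);
  rkhs_repr : forall f x, H f -> X x -> f x = ip f (ksec X k x) }.

Definition unit_ball (R : realType) (d : nat) (H : set ('rV[R]_d -> R))
  (ip : ('rV[R]_d -> R) -> ('rV[R]_d -> R) -> R) : set ('rV[R]_d -> R) :=
  [set f | H f /\ ip f f <= 1].

Definition supnorm (R : realType) (d : nat) (X : set 'rV[R]_d)
  (f : 'rV[R]_d -> R) : \bar R :=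
  ereal_sup [set (`|f y|)%:E | y in X].

Definition L2 (R : realType) (d : nat) (rho : probability (BorelE R d) R)
  (X : set 'rV[R]_d) (g : 'rV[R]_d -> R) : Prop :=
  measurable_fun (X : set (BorelE R d)) (g : BorelE R d -> R) /\
  rho.-integrable (X : set (BorelE R d)) (fun y : BorelE R d => (g y ^+ 2)%:E).

Definition ipL2 (R : realType) (d : nat) (rho : probability (BorelE R d) R)
  (X : set 'rV[R]_d) (g h : 'rV[R]_d -> R) : R :=
  Rintegral rho (X : set (BorelE R d)) (fun y : BorelE R d => g y * h y).

Definition aeq (R : realType) (d : nat) (rho : probability (BorelE R d) R)
  (X : set 'rV[R]_d) (g h : 'rV[R]_d -> R) : Prop :=
  {ae rho, forall y : BorelE R d, X y -> g y = h y}.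

Definition Kop (R : realType) (d : nat) (rho : probability (BorelE R d) R)
  (X : set 'rV[R]_d) (k : 'rV[R]_d -> 'rV[R]_d -> R) (g : 'rV[R]_d -> R)
  : 'rV[R]_d -> R :=
  fun x => Rintegral rho (X : set (BorelE R d)) (fun y : BorelE R d => k x y * g y).

(* lam (indexed from 0: lam 0 = lambda_1) is the sequence of eigenvalues of
   K_rho on L^2(rho), nonincreasing, with multiplicity, padded with zeros:
   the e i (lam i > 0) are orthonormal eigenfunctions, and for every mu > 0
   they span the whole mu-eigenspace (an eigenfunction orthogonal to all
   e i with lam i = mu is 0).  Hence each mu > 0 occurs in lam exactly
   dim ker(K_rho - mu) times, and no other positive value occurs. *)
Definition is_eigseq (R : realType) (d : nat) (rho : probability (BorelE R d) R)
  (X : set 'rV[R]_d) (k : 'rV[R]_d -> 'rV[R]_d -> R) (lam : nat -> R) : Prop :=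
  [/\ (forall i, 0 <= lam i),
      (forall i j, (i <= j)%N -> lam j <= lam i) &
      exists e : nat -> 'rV[R]_d -> R,
        [/\ (forall i, 0 < lam i -> L2 rho X (e i)),
            (forall i j, 0 < lam i -> 0 < lam j ->
               ipL2 rho X (e i) (e j) = (i == j)%:R),
            (forall i, 0 < lam i ->
               aeq rho X (Kop rho X k (e i)) (fun y => lam i * e i y)) &
            (forall (mu : R) g, 0 < mu -> L2 rho X g ->
               aeq rho X (Kop rho X k g) (fun y => mu * g y) ->
               (forall i, lam i = mu -> ipL2 rho X g (e i) = 0) ->
               aeq rho X g (fun _ => 0))]].

(* Main.v *)
(* Let h_i in H be the Riesz representer of f |-> int f e_i; it equals K e_i on
   X, hence lam_i e_i almost everywhere, so the v_i = h_i / sqrt lam_i are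
   orthonormal in H and orthogonal in L^2(rho) with squared norms lam_i.  Among
   v_1, ..., v_N choose N - n combinations w_l, orthonormal in H, that vanish at
   all the x_j, and put q = sum_l w_l^2.  For x in X the unit vector
   f_x = q(x)^(-1/2) sum_l w_l(x) w_l vanishes at the x_j and f_x(x) = sqrt q(x),
   so 0, f_x and - f_x all have the same image G 0.  Hence the uniform error is
   at least sqrt q(x), and in the one-sided case G 0 >= sqrt q >= q since q <= 1.
   Finally int q >= sum_(n < i <= N) lam_i by a Ky Fan type argument. *)
Require Import Defs.
From HB Require Import structures.
From mathcomp Require Import all_boot all_order all_algebra.
From mathcomp Require Import all_classical all_reals all_analysis.
From mathcomp Require Import measurable_realfun ring lra.
Import Order.TTheory GRing.Theory Num.Theory.
Import numFieldNormedType.Exports.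
Local Open Scope classical_set_scope.
Local Open Scope ring_scope.

(** * Quadratic polynomials and matrices with orthonormal rows *)

(** Evaluation at the minimiser [- b / a] gives the bound. If [a = 0], a nonzero [b] would let the
    affine function take the value -1. *)
Lemma discr_le (R : realFieldType) (a b c : R) :
  0 <= a -> (forall t, 0 <= a * t ^+ 2 + 2 * b * t + c) -> b ^+ 2 <= a * c.
Proof.
move=> a0 abc; have [a_eq0|a_neq0] := eqVneq a 0.
  have [->|b_neq0] := eqVneq b 0; first by rewrite a_eq0 expr0n mul0r.
  have := abc (- (c + 1) / (2 * b)); rewrite a_eq0 mul0r add0r.
  have -> : 2 * b * (- (c + 1) / (2 * b)) + c = - 1 by field.
  lra.
have {}a0 : 0 < a by rewrite lt_neqAle eq_sym a_neq0.
have := abc (- b / a).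
have -> : a * (- b / a) ^+ 2 + 2 * b * (- b / a) + c = (a * c - b ^+ 2) / a.
  by field.
by rewrite pmulr_lge0 ?invr_gt0// subr_ge0.
Qed.

(** Gram-Schmidt by induction on [m]: a new row must lie in the left kernel of [row_mx E A^T], whose
    [n + m] columns are fewer than its [N] rows, so a nonzero one exists and can be normalised. *)
Lemma orthonormal_rows_in_kernel (R : rcfType) (N n m : nat) (E : 'M[R]_(N, n)) :
  (n + m <= N)%N ->
  exists A : 'M[R]_(m, N), A *m A^T = 1%:M /\ A *m E = 0.
Proof.
elim: m => [|m IH] nmN.
  by exists 0; split; apply/matrixP => -[].
have [A [AA AE]] := IH (leq_trans (leq_add (leqnn n) (leqnSn m)) nmN).
pose F := row_mx E A^T.
have /rowV0Pn[v /sub_kermxP vF v0] : kermx F != 0.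
  rewrite -mxrank_eq0 mxrank_ker -lt0n subn_gt0.
  by rewrite (leq_ltn_trans (rank_leq_col F))// -addnS.
have [vE vA] : v *m E = 0 /\ v *m A^T = 0.
  by move: vF; rewrite mul_mx_row => /eqP; rewrite -(row_mx0 _ 1 n m) => /eqP /eq_row_mx.
pose s := \sum_j v 0 j ^+ 2.
have s_gt0 : 0 < s.
  rewrite lt_neqAle sumr_ge0 ?andbT; last by move=> j _; rewrite sqr_ge0.
  apply: contraNneq v0 => /esym /eqP; rewrite psumr_eq0; last first.
    by move=> j _; rewrite sqr_ge0.
  move=> /allP s0; apply/eqP/rowP => j; rewrite mxE; apply/eqP.
  by rewrite -sqrf_eq0; apply: s0; rewrite mem_index_enum.
pose u := (Num.sqrt s)^-1 *: v.
have uu : u *m u^T = 1%:M.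
  rewrite linearZ /= -scalemxAl -scalemxAr scalerA -invfM -expr2.
  rewrite (sqr_sqrtr (ltW s_gt0)).
  apply/matrixP => i j; rewrite !ord1 !mxE.
  rewrite (eq_bigr (fun j => v 0 j ^+ 2)); last by move=> l _; rewrite mxE expr2.
  by rewrite eqxx; apply: mulVf; rewrite gt_eqF.
have uA : u *m A^T = 0 by rewrite -scalemxAl vA scaler0.
have Au : A *m u^T = 0 by rewrite -[A]trmxK -trmx_mul uA trmx0.
(* [1 + m] is convertible to [m.+1] and is the row count that [col_mx u A] produces. *)
suff : exists B : 'M[R]_(1 + m, N), B *m B^T = 1%:M /\ B *m E = 0 by [].
exists (col_mx u A); split; last first.
  by rewrite mul_col_mx AE -scalemxAl vE scaler0 col_mx0.
by rewrite tr_col_mx mul_col_row uu uA Au AA -scalar_mx_block.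
Qed.

(** The sum is a diagonal entry [b] of the orthogonal projection [A^T *m A]. By idempotence [b] is
    the sum of squares of the [i]-th row, which already contains [b ^+ 2]. *)
Lemma orthonormal_rows_col_le1 (R : realFieldType) (m N : nat) (A : 'M[R]_(m, N))
  (i : 'I_N) : A *m A^T = 1%:M -> \sum_l A l i ^+ 2 <= 1.
Proof.
move=> AA; set b := \sum_l _.
pose c : 'cV[R]_m := col i A.
have cc : c^T *m c = b%:M.
  apply/matrixP => p q; rewrite !ord1 !mxE eqxx mulr1n.
  by apply: eq_bigr => l _; rewrite !mxE expr2.
(* One scalar computed twice: cancelling [A *m A^T] gives [b], expanding the outer product gives a
   sum of squares. *)
have := erefl (c^T *m A *m (A^T *m c)).
rewrite {1}mulmxA -(mulmxA c^T A) AA mulmx1 cc.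
move=> /matrixP /(_ 0 0); rewrite mxE eqxx mulr1n mxE => bE.
have : b ^+ 2 <= b.
  rewrite {2}bE (bigD1 i)//=.
  have -> : (c^T *m A) 0 i = b.
    have -> : b = (c^T *m c) 0 0 by rewrite cc mxE eqxx mulr1n.
    by rewrite !mxE; apply: eq_bigr => l _; rewrite !mxE.
  have -> : (A^T *m c) i 0 = b.
    have -> : b = (c^T *m c) 0 0 by rewrite cc mxE eqxx mulr1n.
    by rewrite !mxE; apply: eq_bigr => l _; rewrite !mxE.
  rewrite -expr2 lerDl sumr_ge0// => j _.
  have -> : (A^T *m c) j 0 = (c^T *m A) 0 j.
    by rewrite -[A^T *m c]trmxK trmx_mul trmxK mxE.
  by rewrite -expr2 sqr_ge0.
have b0 : 0 <= b by rewrite sumr_ge0// => l _; rewrite sqr_ge0.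
nra.
Qed.

(* A Ky Fan type bound: the weights [b_i = sum_l A l i ^+ 2] lie in [0, 1] and
   sum to [m], so the weighted sum is smallest when they sit on the last [m]
   (smallest) values. *)
Lemma orthonormal_rows_trace_ge (R : realFieldType) (n m : nat)
  (A : 'M[R]_(m, n + m)) (lam : nat -> R) :
  A *m A^T = 1%:M -> {homo lam : i j / (i <= j)%N >-> j <= i} ->
  \sum_(n <= i < n + m) lam i <= \sum_(i < n + m) lam i * \sum_l A l i ^+ 2.
Proof.
move=> AA lam_anti; set b := fun i : 'I_(n + m) => \sum_l A l i ^+ 2.
have bm : \sum_i b i = m%:R.
  have -> : m%:R = \sum_(l < m) 1 :> R by rewrite sumr_const card_ord.
  rewrite /b exchange_big /=; apply: eq_bigr => l _.
  move: (AA) => /matrixP /(_ l l); rewrite !mxE eqxx => AAl; rewrite -[RHS]AAl.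
  by apply: eq_bigr => i _; rewrite mxE expr2.
pose t := fun i : 'I_(n + m) => (n <= i)%N%:R : R.
have tm : \sum_i t i = m%:R.
  rewrite /t big_split_ord /= big1 ?add0r; last first.
    by move=> i _; rewrite leqNgt ltn_ord.
  rewrite (eq_bigr (fun=> 1)); last by move=> i _; rewrite leq_addr.
  by rewrite sumr_const card_ord.
have -> : \sum_(n <= i < n + m) lam i = \sum_(i < n + m) lam i * t i.
  rewrite [RHS]big_split_ord /= /t [X in _ = X + _]big1 ?add0r; last first.
    by move=> i _; rewrite /= leqNgt ltn_ord mulr0.
  rewrite -{1}[n]add0n big_addn addKn big_mkord.
  by apply: eq_bigr => i _; rewrite /= leq_addr mulr1 addnC.
rewrite -subr_ge0 -sumrB.
(* Both weights [b] and [t] have total [m], so [lam] may be shifted by the threshold [lam n]. Each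
   summand is then a product of two factors of the same sign. *)
have -> : \sum_(i < n + m) (lam i * b i - lam i * t i) =
          \sum_(i < n + m) (lam i - lam n) * (b i - t i) + lam n * \sum_i (b i - t i).
  by rewrite mulr_sumr -big_split /=; apply: eq_bigr => i _; ring.
rewrite sumrB bm tm subrr mulr0 addr0; apply: sumr_ge0 => i _.
have b0 : 0 <= b i by apply: sumr_ge0 => l _; rewrite sqr_ge0.
have b1 : b i <= 1 by exact: orthonormal_rows_col_le1.
rewrite /t; case: leqP => ni /=.
  by rewrite mulr_le0 // subr_le0//; exact: lam_anti.
by rewrite subr0 mulr_ge0// subr_ge0; apply: lam_anti; exact: ltnW.
Qed.

(** * Bilinear forms on a subspace and the Riesz representation theorem *)

Section inner_product_on_subspace.
Variables (R : realType) (V : lmodType R) (H : set V) (ip : V -> V -> R).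
Hypothesis H0 : H 0.
Hypothesis HD : forall f g, H f -> H g -> H (f + g).
Hypothesis HZ : forall (a : R) f, H f -> H (a *: f).
Hypothesis ipC : forall f g, H f -> H g -> ip f g = ip g f.
Hypothesis ip_lin : forall (a : R) f g h, H f -> H g -> H h ->
  ip (a *: f + g) h = a * ip f h + ip g h.
Hypothesis ip_ge0 : forall f, H f -> 0 <= ip f f.

Lemma subspaceB f g : H f -> H g -> H (f - g).
Proof. by move=> Hf Hg; rewrite -scaleN1r; apply: HD => //; exact: HZ. Qed.

Lemma subspace_sum I (r : seq I) (P : pred I) (F : I -> V) :
  (forall i, P i -> H (F i)) -> H (\sum_(i <- r | P i) F i).
Proof. by move=> HF; elim/big_rec : _ => // i x Pi Hx; apply: HD => //; exact: HF. Qed.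

Lemma ip_0l h : H h -> ip 0 h = 0.
Proof.
move=> Hh; have := ip_lin 1 0 0 h H0 H0 Hh.
rewrite scaler0 addr0 mul1r; lra.
Qed.

Lemma ip_Dl f g h : H f -> H g -> H h -> ip (f + g) h = ip f h + ip g h.
Proof. by move=> Hf Hg Hh; rewrite -{1}[f]scale1r ip_lin// mul1r. Qed.

Lemma ip_Zl a f h : H f -> H h -> ip (a *: f) h = a * ip f h.
Proof. by move=> Hf Hh; rewrite -[a *: f]addr0 ip_lin// ip_0l// addr0. Qed.

Lemma ip_Dr f g h : H f -> H g -> H h -> ip h (f + g) = ip h f + ip h g.
Proof. by move=> Hf Hg Hh; rewrite ipC ?ip_Dl// ?(ipC h)//; exact: HD. Qed.

Lemma ip_Zr a f h : H f -> H h -> ip h (a *: f) = a * ip h f.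
Proof. by move=> Hf Hh; rewrite ipC ?ip_Zl// ?(ipC h)//; exact: HZ. Qed.

Lemma ip_sumr (I : Type) (r : seq I) (c : I -> R) (F : I -> V) h :
  (forall i, H (F i)) -> H h ->
  ip h (\sum_(i <- r) c i *: F i) = \sum_(i <- r) c i * ip h (F i).
Proof.
move=> HF Hh; elim: r => [|i r IH]; first by rewrite !big_nil ipC// ip_0l.
rewrite !big_cons ip_Dr ?ip_Zr ?IH//; first exact: HZ.
by apply: subspace_sum => j _; exact: HZ.
Qed.

(** The weights [mu] serve two forms: the inner product of the RKHS, with [mu = 1], and the [L^2]
    form on the same functions, with the eigenvalues as [mu]. *)
Lemma ip_sum_orthogonal (I : finType) (a b mu : I -> R) (F : I -> V) :
  (forall i, H (F i)) -> (forall i j, ip (F i) (F j) = mu i * (i == j)%:R) ->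
  ip (\sum_i a i *: F i) (\sum_i b i *: F i) = \sum_i mu i * (a i * b i).
Proof.
move=> HF FF; have HS : H (\sum_i a i *: F i).
  by apply: subspace_sum => j _; exact: HZ.
rewrite ip_sumr//; apply: eq_bigr => i _.
rewrite ipC// ip_sumr// (bigD1 i)//= big1 ?addr0 ?FF ?eqxx.
  by rewrite mulr1; ring.
by move=> j ji; rewrite FF eq_sym (negbTE ji) !mulr0.
Qed.

Lemma ip_sqD f g t : H f -> H g ->
  ip (t *: f + g) (t *: f + g) = ip f f * t ^+ 2 + 2 * ip g f * t + ip g g.
Proof.
move=> Hf Hg; have Htf := HZ t f Hf; have HS := HD _ _ Htf Hg.
rewrite ip_lin// !ip_Dr// !ip_Zr// (ipC f g)//; ring.
Qed.

Lemma ip_cauchy_schwarz f g : H f -> H g -> ip f g ^+ 2 <= ip f f * ip g g.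
Proof.
move=> Hf Hg; rewrite (ipC f g)//; apply: discr_le; first exact: ip_ge0.
by move=> t; rewrite -ip_sqD//; apply: ip_ge0; apply: HD => //; exact: HZ.
Qed.

Hypothesis H_complete : forall u : nat -> V, (forall m, H (u m)) ->
  (forall e : R, 0 < e -> exists N, forall m p, (N <= m)%N -> (N <= p)%N ->
     ip (u m - u p) (u m - u p) < e) ->
  exists f, H f /\ (fun m => ip (u m - f) (u m - f)) @ \oo --> (0 : R).

(* The representer minimises [ip f f - 2 * L f]; by the parallelogram law any
   minimising sequence is Cauchy. *)
Lemma riesz_representer (L : V -> R) (C : R) :
  (forall a f g, H f -> H g -> L (a *: f + g) = a * L f + L g) ->
  0 <= C -> (forall f, H f -> L f ^+ 2 <= C * ip f f) ->
  exists2 h, H h & forall f, H f -> ip f h = L f.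
Proof.
move=> L_lin C0 L_bnd; pose J f := ip f f - 2 * L f.
(* With p = [ip f f] and l = [L f], a violation means p + C < 2l; squaring and using l^2 <= C p
   contradicts (p - C)^2 >= 0. *)
have J_ge f : H f -> - C <= J f.
  move=> Hf; have := L_bnd f Hf; have := ip_ge0 f Hf.
  rewrite /J; move: (ip f f) (L f) => p l p0 lp; rewrite leNgt; apply/negP => pl.
  have : (p + C) ^+ 2 < (2 * l) ^+ 2 by rewrite ltr_sqr ?nnegrE; lra.
  have := sqr_ge0 (p - C); nra.
pose S := [set J f | f in H].
have S_inf : has_inf S.
  by split; [exists (J 0), 0|exists (- C) => _ [f Hf <-]; exact: J_ge].
have inf_le f : H f -> inf S <= J f.
  by move=> Hf; apply: ge_inf; [exact: S_inf.2|exists f].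
have /choice[u uP] m : exists f, H f /\ J f < inf S + m.+1%:R^-1.
  have m0 : 0 < m.+1%:R^-1 :> R by rewrite invr_gt0.
  by have [_ [f Hf <-] Jf] := inf_adherent m0 S_inf; exists f.
have Hu m : H (u m) := (uP m).1.
have inv_lt (e : R) : 0 < e -> exists N, forall m, (N <= m)%N -> m.+1%:R^-1 < e.
  move=> e0; exists (Num.truncn e^-1) => m Nm.
  rewrite invf_plt ?posrE//; apply: lt_le_trans (truncnS_gt _) _.
  by rewrite ler_nat ltnS.
have [h [Hh uh]] : exists f, H f /\ (fun m => ip (u m - f) (u m - f)) @ \oo --> (0 : R).
  apply: H_complete => // e e0.
  (* The midpoint has [J] at least [inf S], so half the squared distance of [u m] and [u p] is below
     the sum of their two excesses; two excesses under [e / 4] give the bound [e]. *)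
  have [N NP] := inv_lt (e / 4) ltac:(lra).
  exists N => m p Nm Np.
  have mid := inf_le (2^-1 *: (u m + u p)) (HZ _ _ (HD _ _ (Hu m) (Hu p))).
  have L_mid : L (2^-1 *: (u m + u p)) = 2^-1 * (L (u m) + L (u p)).
    have L0 : L 0 = 0.
      by have := L_lin 1 0 0 H0 H0; rewrite scaler0 addr0 mul1r; lra.
    rewrite -[_ *: _]addr0 L_lin//; last exact: HD.
    by rewrite L0 addr0 -[u m]scale1r L_lin// mul1r scale1r.
  have := NP _ Nm; have := NP _ Np.
  have -> : u m - u p = (-1) *: u p + u m by rewrite scaleN1r addrC.
  have -> := ip_sqD _ _ (-1) (Hu p) (Hu m).
  have := (uP m).2; have := (uP p).2; move: mid; rewrite /J L_mid.
  have -> : 2^-1 *: (u m + u p) = 2^-1 *: u p + 2^-1 *: u m.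
    by rewrite addrC scalerDr.
  rewrite ip_sqD ?ip_Zl ?ip_Zr//; do ?exact: HZ.
  move: (inf S) (ip _ _) (ip _ _) (ip _ _) (L _) (L _) (m.+1%:R^-1) (p.+1%:R^-1) => *; lra.
exists h => // f Hf.
have key (e : R) : 0 < e -> (ip h f - L f) ^+ 2 <= 2 * e * ip f f + 2 * e * ip f f.
  move=> e0; have [N NP] := inv_lt e e0.
  have [M _ MP] : \forall m \near \oo, ip (u m - h) (u m - h) < e.
    have /cvgrPdist_lt/(_ e e0) := uh.
    by apply: filterS => m; rewrite sub0r normrN; apply: le_lt_trans; rewrite ler_norm.
  pose m := maxn N M.
  have e1 : m.+1%:R^-1 < e by apply: NP; rewrite leq_maxl.
  have e2 : ip (u m - h) (u m - h) < e by apply: MP; rewrite /= leq_maxr.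
  (* Approximate stationarity: [J] cannot drop by more than [e] from [u m] in the direction [f], so
     a quadratic in [t] with constant term [e] is nonnegative. *)
  have d1 : (ip (u m) f - L f) ^+ 2 <= ip f f * e.
    apply: discr_le; first exact: ip_ge0.
    move=> t; have := inf_le (t *: f + u m) (HD _ _ (HZ _ _ Hf) (Hu m)).
    have := (uP m).2; rewrite /J ip_sqD// L_lin//; move: e1.
    move: (ip _ _) (ip _ _) (ip _ _) (L _) (L _) (_^-1) (t ^+ 2) => *; nra.
  have Huh := subspaceB _ _ (Hu m) Hh.
  have d2 := ip_cauchy_schwarz _ _ Huh Hf.
  have e3 : ip (u m - h) f = ip (u m) f - ip h f.
    by rewrite addrC -scaleN1r ip_lin// mulN1r addrC.
  have := ip_ge0 _ Hf; have := ip_ge0 _ Huh; move: d1 d2 e2; rewrite e3.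
  move: (ip (u m - h) _) (ip (u m) f) (ip h f) (ip f f) (L f).
  move=> p x y q l d1 d2 pe p0 q0.
  have := sqr_ge0 ((x - l) + (x - y)); have := ler_wpM2r q0 (ltW pe); nra.
rewrite ipC//; apply/eqP; rewrite -subr_eq0 -sqrf_eq0 eq_le sqr_ge0 andbT.
apply/ler_addgt0Pr => e e0; rewrite add0r.
(* This scaling turns the bound of [key] into at most [e]; the added 1 keeps the denominator
   positive when [ip f f = 0]. *)
have f0 := ip_ge0 _ Hf; have f1 : 0 < 4 * (ip f f + 1) by lra.
apply: le_trans (key (e / (4 * (ip f f + 1))) (divr_gt0 e0 f1)) _.
have -> : 2 * (e / (4 * (ip f f + 1))) * ip f f + 2 * (e / (4 * (ip f f + 1))) * ip f f
   = e * (ip f f / (ip f f + 1)).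
  by field; apply/eqP => e1; lra.
by rewrite ler_piMr ?(ltW e0)// ler_pdivrMr ?mul1r; lra.
Qed.

End inner_product_on_subspace.

(** * Measurability and integration preliminaries *)

Lemma compact_measurable_BorelE (R : realType) (d : nat) (X : set 'rV[R]_d) :
  compact X -> measurable (X : set (BorelE R d)).
Proof.
move=> cX; have /closed_openC oX : closed X.
  by apply: compact_closed => //; exact: norm_hausdorff.
by rewrite -[X]setCK; apply: measurableC; exact: sub_sigma_algebra.
Qed.

Lemma within_continuous_measurable_BorelE (R : realType) (d : nat)
  (X : set 'rV[R]_d) (f : 'rV[R]_d -> R) :
  measurable (X : set (BorelE R d)) -> {within X, continuous f} ->
  measurable_fun (X : set (BorelE R d)) (f : BorelE R d -> R).
Proof.
move=> mX /continuousP cf; apply: (measurability _ (RGenOpens.measurableE R)).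
move=> _ [_ [a [b ->] <-]].
have /open_subspaceP[U oU UX] := cf _ (interval_open (a := BRight a) (b := BLeft b) isT isT).
rewrite setIC -[_ `&` X]UX; apply: measurableI => //.
exact: sub_sigma_algebra.
Qed.

(** On a finite measure [1 + g ^+ 2] is integrable, and it dominates the absolute value of [g]. *)
Lemma integrable_of_sqr d (T : measurableType d) (R : realType)
  (mu : {finite_measure set T -> \bar R}) (D : set T) (g : T -> R) :
  measurable D -> measurable_fun D g ->
  mu.-integrable D (fun x => (g x ^+ 2)%:E) -> mu.-integrable D (EFin \o g).
Proof.
move=> mD mg ig2.
have i1 : mu.-integrable D (EFin \o cst 1) by exact: finite_measure_integrable_cst.
apply: (le_integrable mD _ _ (integrableD mD i1 ig2)).
  exact/measurable_EFinP.
move=> x _ /=; rewrite lee_fin.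
have := sqr_ge0 (`|g x| - 1); rewrite sqrrB real_normK ?num_real// => g1.
by rewrite [leRHS]ger0_norm; have := sqr_ge0 (g x); lra.
Qed.

Lemma Rintegral_sum d (T : measurableType d) (R : realType)
  (mu : {measure set T -> \bar R}) (D : set T) I (s : seq I) (F : I -> T -> R) :
  measurable D -> (forall i, mu.-integrable D (EFin \o F i)) ->
  mu.-integrable D (EFin \o (fun x => \sum_(i <- s) F i x)) /\
  \int[mu]_(x in D) (\sum_(i <- s) F i x) = \sum_(i <- s) \int[mu]_(x in D) F i x.
Proof.
move=> mD iF; elim: s => [|i s [IHi IH]].
  under eq_fun do rewrite big_nil.
  rewrite big_nil; split; first exact: integrable0.
  by rewrite /Rintegral integral0.
under eq_fun do rewrite big_cons.
rewrite big_cons; split; first exact: (integrableD mD (iF i) IHi).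
by rewrite RintegralD// IH.
Qed.

Lemma ae_eq_Rintegral d (T : measurableType d) (R : realType)
  (mu : {measure set T -> \bar R}) (D : set T) (f g : T -> R) :
  measurable D -> measurable_fun D f -> measurable_fun D g ->
  {ae mu, forall x, D x -> f x = g x} ->
  \int[mu]_(x in D) f x = \int[mu]_(x in D) g x.
Proof.
move=> mD mf mg fg; rewrite /Rintegral; congr fine.
apply: ae_eq_integral => //; [exact/measurable_EFinP|exact/measurable_EFinP|].
by apply: filterS fg => x fg Dx; rewrite fg.
Qed.

(** * The RKHS, its embedding in [L^2], and functions invisible at the nodes *)

Section rkhs.
Variables (R : realType) (d : nat) (X : set 'rV[R]_d).
Variables (k : 'rV[R]_d -> 'rV[R]_d -> R) (H : set ('rV[R]_d -> R)).
Variable ip : ('rV[R]_d -> R) -> ('rV[R]_d -> R) -> R.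
Hypothesis k_pd : cont_pd_kernel X k.
Hypothesis k_le1 : forall x, X x -> k x x <= 1.
Hypothesis rk : is_RKHS X k H ip.
Local Notation B := (BorelE R d).

(** The fields of [is_RKHS] use explicit pointwise functions. They are retyped here with the
    convertible module operations, so that the results on subspaces apply. *)
Let H0 : H 0 := rkhs_0 rk.
Let HD (f g : 'rV[R]_d -> R) : H f -> H g -> H (f + g) :=
  @rkhs_add _ _ _ _ _ _ rk f g.
Let HZ (a : R) (f : 'rV[R]_d -> R) : H f -> H (a *: f) :=
  @rkhs_scale _ _ _ _ _ _ rk a f.
Let ipC := @rkhs_sym _ _ _ _ _ _ rk.
Let ip_lin (a : R) (f g h : 'rV[R]_d -> R) : H f -> H g -> H h ->
  ip (a *: f + g) h = a * ip f h + ip g h := @rkhs_lin _ _ _ _ _ _ rk a f g h.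
Let ip_ge0 := @rkhs_pos _ _ _ _ _ _ rk.
Let ip_CS := @ip_cauchy_schwarz _ _ _ _ H0 HD HZ ipC ip_lin ip_ge0.

Lemma ip_ksec x y : X x -> X y -> ip (ksec X k x) (ksec X k y) = k x y.
Proof.
move=> Xx Xy; rewrite -(rkhs_repr rk) //; last exact: (rkhs_ksec rk).
by rewrite /ksec asboolT.
Qed.

Lemma rkhs_sqr_le f x : H f -> X x -> f x ^+ 2 <= ip f f.
Proof.
move=> Hf Xx; have Hx := rkhs_ksec rk Xx.
rewrite {1}(rkhs_repr rk Hf Xx); apply: le_trans (ip_CS _ _ Hf Hx) _.
by rewrite ip_ksec// ler_piMr ?ip_ge0 ?k_le1.
Qed.

(** The second factor is the squared [H]-norm of the difference of the kernel sections at [x] and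
    [y]; the bound is Cauchy-Schwarz. *)
Lemma rkhs_dist_le f x y : H f -> X x -> X y ->
  (f x - f y) ^+ 2 <= ip f f * (k x x - 2 * k x y + k y y).
Proof.
move=> Hf Xx Xy; have Hx := rkhs_ksec rk Xx; have Hy := rkhs_ksec rk Xy.
have -> : f x - f y = ip f ((-1) *: ksec X k y + ksec X k x).
  rewrite (ip_Dr _ _ _ _ HD ipC ip_lin) ?(ip_Zr _ _ _ _ H0 HZ ipC ip_lin)//;
    last exact: HZ.
  by rewrite -!(rkhs_repr rk)// mulN1r addrC.
apply: le_trans (ip_CS _ _ Hf (HD _ _ (HZ _ _ Hy) Hx)) _.
rewrite (ip_sqD _ _ _ _ H0 HD HZ ipC ip_lin)// !ip_ksec//.
by rewrite ler_wpM2l ?ip_ge0//; lra.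
Qed.

Lemma rkhs_continuous f : H f -> {within X, continuous f}.
Proof.
move=> Hf; apply/subspace_continuousP => x Xx.
apply/cvgrPdist_lt => e e0.
have [kc _ _] := k_pd; have /subspace_continuousP/(_ (x, x)) := kc.
move=> /(_ (conj Xx Xx))/cvgrPdist_lt => kx.
have f0 := ip_ge0 _ Hf; have f1 : 0 < 3 * (ip f f + 1) by lra.
(* Continuity of [k] at [(x, x)] is used at [(x, y)] and [(y, y)]: two errors below [c] in the first
   and one in the second bound the squared section distance by [3 * c]. *)
pose c := e ^+ 2 / (3 * (ip f f + 1)).
have c0 : 0 < c by rewrite divr_gt0 ?exprn_gt0.
have [[U1 U2] /= [nU1 nU2] UU] := kx c c0.
suff : nbhs x [set y | X y -> `|f x - f y| < e] by [].
apply: filterS (filterI nU1 nU2) => y [y1 y2] Xy.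
have kxy : `|k x x - k x y| < c := UU (x, y) (conj (nbhs_singleton nU1) y2) (conj Xx Xy).
have kyy : `|k x x - k y y| < c := UU (y, y) (conj y1 y2) (conj Xy Xy).
have := rkhs_dist_le f x y Hf Xx Xy.
move: kxy kyy; rewrite !ltr_norml => /andP[k1 k2] /andP[k3 k4] fxy.
have fxy2 : (f x - f y) ^+ 2 < e ^+ 2.
  apply: le_lt_trans fxy _; apply: (@le_lt_trans _ _ (ip f f * (3 * c))).
    by rewrite ler_wpM2l//; lra.
  have -> : ip f f * (3 * c) = e ^+ 2 * (ip f f / (ip f f + 1)).
    by rewrite /c; field; apply/eqP => E; lra.
  rewrite -[ltRHS]mulr1 ltr_pM2l ?exprn_gt0//.
  by rewrite ltr_pdivrMr ?mul1r; lra.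
apply/andP; split; nra.
Qed.

Hypothesis cX : compact X.
Variable rho : probability (BorelE R d) R.

Let mX : measurable (X : set B) := @compact_measurable_BorelE R d X cX.

Lemma rkhs_measurable f : H f -> measurable_fun (X : set B) (f : B -> R).
Proof.
by move=> Hf; apply: within_continuous_measurable_BorelE mX _; exact: rkhs_continuous.
Qed.

Lemma rkhs_norm_le f x : H f -> X x -> `|f x| <= Num.sqrt (ip f f).
Proof.
by move=> Hf Xx; rewrite -sqrtr_sqr ler_wsqrtr// rkhs_sqr_le.
Qed.

Lemma rkhs_bounded f : H f -> [bounded f x : R | x in (X : set B)].
Proof.
move=> Hf; exists (Num.sqrt (ip f f)); split; first exact: num_real.
move=> M fM x Xx; exact: le_trans (rkhs_norm_le f x Hf Xx) (ltW fM).
Qed.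

Lemma rkhs_mul_integrable f (g : B -> R) : H f ->
  rho.-integrable (X : set B) (EFin \o g) ->
  rho.-integrable (X : set B) (EFin \o (fun y : B => f y * g y)).
Proof.
move=> Hf ig.
exact: (integrableMr mX (rkhs_measurable f Hf) (rkhs_bounded f Hf) ig).
Qed.

Lemma rkhs_integrable f : H f ->
  rho.-integrable (X : set B) (EFin \o (f : B -> R)).
Proof.
move=> Hf; apply: measurable_bounded_integrable => //.
- by rewrite ltey_eq fin_num_measure.
- exact: rkhs_measurable.
- exact: rkhs_bounded.
Qed.

(** Members of [H] are bounded on [X], so mere integrability of [h] suffices; this covers both
    eigenfunctions and members of [H]. *)
Lemma ipL2_lin a f g (h : B -> R) : H f -> H g ->
  rho.-integrable (X : set B) (EFin \o h) ->
  ipL2 rho X (a *: f + g) h = a * ipL2 rho X f h + ipL2 rho X g h.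
Proof.
move=> Hf Hg ih; rewrite /ipL2.
have ifh := rkhs_mul_integrable f h Hf ih.
have iafh := rkhs_mul_integrable _ h (HZ a f Hf) ih.
have igh := rkhs_mul_integrable g h Hg ih.
rewrite -RintegralZl//.
have -> : (\int[rho]_(x in (X : set B)) (a * (f x * h x)) =
           \int[rho]_(x in (X : set B)) ((a *: f) x * h x))%R.
  by apply: eq_Rintegral => x _; rewrite mulrA.
rewrite -RintegralD//.
by apply: eq_Rintegral => x _; rewrite -mulrDl.
Qed.

(** Provides an everywhere defined version of [Kop rho X k g] inside [H]. Pointwise values are
    bounded by the [H]-norm, so integration against [g] is a bounded functional; testing its
    representer on kernel sections identifies it. *)
Lemma Kop_representer g : L2 rho X g ->
  exists2 h, H h & (forall f, H f -> ip f h = ipL2 rho X f g) /\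
                   (forall x, X x -> h x = Kop rho X k g x).
Proof.
move=> [mg ig2]; have ig := integrable_of_sqr _ _ _ _ _ _ mX mg ig2.
pose C := (\int[rho]_(x in (X : set B)) `|g x|)%R.
have C0 : 0 <= C by exact: Rintegral_ge0.
have bnd f : H f -> ipL2 rho X f g ^+ 2 <= C ^+ 2 * ip f f.
  move=> Hf; have ifg := rkhs_mul_integrable f g Hf ig.
  rewrite -[ip f f]sqr_sqrtr ?ip_ge0// -exprMn -real_normK ?num_real//.
  rewrite ler_sqr ?nnegrE ?mulr_ge0 ?sqrtr_ge0//.
  apply: le_trans (le_normr_Rintegral mX ifg) _.
  rewrite /C -RintegralZr//; last exact: integrable_norm.
  apply: le_Rintegral => //.
  - exact: integrable_norm.
  - exact: (integrableZr mX (Num.sqrt (ip f f)) (integrable_norm ig)).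
  - move=> x Xx; rewrite normrM mulrC ler_wpM2l//; exact: rkhs_norm_le.
have [h Hh hP] := @riesz_representer _ _ _ _ H0 HD HZ ipC ip_lin ip_ge0
  (@rkhs_complete _ _ _ _ _ _ rk) (fun f => ipL2 rho X f g) (C ^+ 2)
  (fun a f g' Hf Hg => ipL2_lin a f g' g Hf Hg ig) (sqr_ge0 _) bnd.
exists h => //; split=> // x Xx.
rewrite (rkhs_repr rk Hh Xx) ipC//; last exact: (rkhs_ksec rk).
rewrite hP; last exact: (rkhs_ksec rk).
by apply: eq_Rintegral => y /set_mem Xy; rewrite /ksec asboolT.
Qed.

Lemma ipL2C f g : ipL2 rho X f g = ipL2 rho X g f.
Proof. by apply: eq_Rintegral => x _; rewrite mulrC. Qed.

Let ipL2_lin_rkhs a f g h (Hf : H f) (Hg : H g) (Hh : H h) :=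
  ipL2_lin a f g h Hf Hg (rkhs_integrable h Hh).
Let ipL2C_rkhs f g (_ : H f) (_ : H g) := ipL2C f g.

Lemma eigenfunctions_in_rkhs (lam : nat -> R) (N : nat) :
  is_eigseq rho X k lam -> (forall i, (i < N)%N -> 0 < lam i) ->
  exists v : 'I_N -> 'rV[R]_d -> R,
    [/\ (forall i, H (v i)), (forall i j, ip (v i) (v j) = (i == j)%:R) &
        (forall i j, ipL2 rho X (v i) (v j) = lam i * (i == j)%:R)].
Proof.
move=> [_ _ [e [eL2 e_on eK _]]] lam_gt0.
have lam0 (i : 'I_N) : 0 < lam i by exact: lam_gt0.
have /choice[h hP] (i : 'I_N) : exists h, [/\ H h,
    (forall f, H f -> ip f h = ipL2 rho X f (e i)) &
    (forall x, X x -> h x = Kop rho X k (e i) x)].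
  by have [h Hh [h1 h2]] := Kop_representer _ (eL2 _ (lam0 i)); exists h.
have Hh i : H (h i) by have [] := hP i.
have iph i f : H f -> ip f (h i) = ipL2 rho X f (e i) by have [_ + _] := hP i; apply.
have me (i : 'I_N) : measurable_fun (X : set B) (e i : B -> R).
  by have [] := eL2 _ (lam0 i).
have ie (i : 'I_N) : rho.-integrable (X : set B) (EFin \o (e i : B -> R)).
  by have [m1 m2] := eL2 _ (lam0 i); exact: integrable_of_sqr.
have hae i : aeq rho X (h i) (fun y => lam i * e i y).
  have := eK _ (lam0 i); apply: filterS => y eKy Xy.
  by have [_ _ ->//] := hP i; exact: eKy.
(* Since [h i] is [lam i] times [e i] almost everywhere, pairing with [h i] in [L^2] is [lam i]
   times pairing with it in [H]. Hence one family diagonalises both forms. *)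
have ipL2h i f : H f -> ipL2 rho X f (h i) = lam i * ip f (h i).
  move=> Hf; rewrite iph// /ipL2 -RintegralZl//; last exact: rkhs_mul_integrable.
  apply: ae_eq_Rintegral => //.
  - by apply: measurable_funM; exact: rkhs_measurable.
  - apply: measurable_funM; first exact: measurable_cst.
    by apply: measurable_funM => //; exact: rkhs_measurable.
  - by apply: filterS (hae i) => y hy Xy; rewrite hy// mulrCA.
have iphh i j : ip (h i) (h j) = lam i * (i == j)%:R.
  rewrite iph//.
  suff : (lam i)^-1 * ipL2 rho X (h i) (e j) = (i == j)%:R.
    by move=> <-; rewrite mulrA mulfV ?mul1r// gt_eqF.
  rewrite -val_eqE -(e_on i j)// /ipL2 -RintegralZl//; last exact: rkhs_mul_integrable.
  apply: ae_eq_Rintegral => //.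
  - apply: measurable_funM; first exact: measurable_cst.
    by apply: measurable_funM => //; exact: rkhs_measurable.
  - exact: measurable_funM.
  - apply: filterS (hae i) => y hy Xy.
    by rewrite hy// !mulrA mulVf ?mul1r// gt_eqF.
exists (fun i : 'I_N => (Num.sqrt (lam i))^-1 *: h i).
have Hv (i : 'I_N) : H ((Num.sqrt (lam i))^-1 *: h i) by exact: HZ.
have s0 (i : 'I_N) : Num.sqrt (lam i) != 0 by rewrite gt_eqF// sqrtr_gt0.
have ipv (i j : 'I_N) : ip ((Num.sqrt (lam i))^-1 *: h i) ((Num.sqrt (lam j))^-1 *: h j) =
    (i == j)%:R.
  rewrite (ip_Zr _ _ _ _ H0 HZ ipC ip_lin)// (ip_Zl _ _ _ _ H0 ip_lin)// iphh.
  have [->|_] := eqVneq i j; last by rewrite !mulr0.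
  have := sqr_sqrtr (ltW (lam0 j)); move: (s0 j).
  by move: (Num.sqrt _) => s sj <-; field.
split => // i j.
rewrite (ip_Zr _ _ _ _ H0 HZ ipL2C_rkhs ipL2_lin_rkhs)// ipL2h//.
have := ipv i j; rewrite (ip_Zr _ _ _ _ H0 HZ ipC ip_lin)// => ipvh.
rewrite mulrCA ipvh; have [->//|_] := eqVneq i j; by rewrite !mulr0.
Qed.

(** Here [q x] is the squared norm of the projection of the kernel section at [x] onto the span of
    the [w l], and [f] is that projection normalised. *)
Lemma residual_function (lam : nat -> R) (n m : nat) (xs : 'I_n -> 'rV[R]_d) :
  is_eigseq rho X k lam -> (forall i, (i < n + m)%N -> 0 < lam i) ->
  exists q : B -> R,
    [/\ measurable_fun (X : set B) q, (forall x, 0 <= q x),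
        ((\sum_(n <= i < n + m) lam i)%:E <=
          \int[rho]_(x in (X : set B)) (q x)%:E)%E &
        forall x, X x -> q x <= 1 /\ exists f,
          [/\ unit_ball H ip f, (forall i, f (xs i) = 0) & f x = Num.sqrt (q x)]].
Proof.
move=> eig lam_gt0.
have [v [Hv ipv ipL2v]] := eigenfunctions_in_rkhs lam (n + m) eig lam_gt0.
(* Rows of [A] are coefficient vectors in the basis [v]; the [n] columns of the matrix of node
   values impose vanishing at the nodes, leaving [m] of [n + m] dimensions. *)
have [A [AA AE]] := orthonormal_rows_in_kernel R (n + m) n m
  (\matrix_(i, j) v i (xs j)) (leqnn _).
pose w l := \sum_i A l i *: v i.
have Hw l : H (w l) by apply: (subspace_sum _ _ _ H0 HD) => i _; exact: HZ.
have wE l x : w l x = \sum_i A l i * v i x by rewrite /w fct_sumE.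
have w_xs l j : w l (xs j) = 0.
  have /matrixP/(_ l j) := AE; rewrite !mxE => <-; rewrite wE.
  by apply: eq_bigr => i _; rewrite mxE.
have ipw l l' : ip (w l) (w l') = 1 * (l == l')%:R.
  rewrite (ip_sum_orthogonal _ _ _ _ H0 HD HZ ipC ip_lin _ _ _ (fun=> 1))//.
    have /matrixP/(_ l l') := AA; rewrite !mxE mul1r => <-.
    by apply: eq_bigr => i _; rewrite mxE mul1r.
  by move=> i j; rewrite ipv mul1r.
have ipL2w l : ipL2 rho X (w l) (w l) = \sum_(i < n + m) lam i * (A l i * A l i).
  exact: (ip_sum_orthogonal _ _ _ _ H0 HD HZ ipL2C_rkhs ipL2_lin_rkhs _ _ _
    (fun i : 'I_(n + m) => lam i)).
pose q x := \sum_l w l x * w l x.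
have q0 x : 0 <= q x by apply: sumr_ge0 => l _; rewrite -expr2 sqr_ge0.
have iww l : rho.-integrable (X : set B) (EFin \o (fun y : B => w l y * w l y)).
  by apply: rkhs_mul_integrable => //; exact: rkhs_integrable.
have [iq intq] := Rintegral_sum _ _ _ rho _ _ (index_enum 'I_m) _ mX iww.
exists q; split => //.
- by apply/measurable_EFinP; exact: measurable_int iq.
- rewrite -[leRHS]fineK; last exact: integrable_fin_num.
  rewrite lee_fin; apply: (@le_trans _ _ (\sum_l \sum_(i < n + m) lam i * (A l i * A l i))).
    have [_ lam_anti _] := eig.
    have := orthonormal_rows_trace_ge _ n m A lam AA lam_anti.
    congr (_ <= _); rewrite exchange_big /=; apply: eq_bigr => i _.
    by rewrite mulr_sumr; apply: eq_bigr => l _; rewrite expr2.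
  under eq_bigr do rewrite -ipL2w.
  by rewrite -intq.
- move=> x Xx; pose s := Num.sqrt (q x).
  (* If [q x = 0], then [s^-1] is 0 by convention and [f] is the zero function, which still takes
     the value [s] at [x]. *)
  pose f := \sum_l (s^-1 * w l x) *: w l.
  have Hf : H f by apply: (subspace_sum _ _ _ H0 HD) => l _; exact: HZ.
  have s2 : s ^+ 2 = q x by rewrite sqr_sqrtr.
  have fx : f x = s.
    have -> : f x = s^-1 * q x.
      rewrite /f fct_sumE /q mulr_sumr; apply: eq_bigr => l _.
      by rewrite mulrA.
    rewrite -s2; have [->|s_neq0] := eqVneq s 0; first by rewrite expr0n mulr0.
    by field.
  have ff : ip f f <= 1.
    rewrite (ip_sum_orthogonal _ _ _ _ H0 HD HZ ipC ip_lin _ _ _ (fun=> 1))//.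
    have -> : \sum_l 1 * (s^-1 * w l x * (s^-1 * w l x)) = s^-1 ^+ 2 * s ^+ 2.
      by rewrite s2 /q mulr_sumr; apply: eq_bigr => l _; ring.
    by rewrite -exprMn; have [->|s_neq0] := eqVneq s 0;
      [rewrite mulr0 expr0n|rewrite mulVf// expr1n].
  split.
    rewrite -s2 -fx; exact: le_trans (rkhs_sqr_le f x Hf Xx) ff.
  exists f; split => // i.
  by rewrite /f fct_sumE big1// => l _; rewrite -[RHS](mulr0 (s^-1 * w l x)) -(w_xs l i).
Qed.

End rkhs.

(* Once a term vanishes all later ones do, so only partial sums over positive
   terms matter. *)
Lemma nneseries_le_of_pos (R : realType) (lam : nat -> R) (n : nat) (b : \bar R) :
  (forall i, 0 <= lam i) -> {homo lam : i j / (i <= j)%N >-> j <= i} ->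
  (0 <= b)%E ->
  (forall m, (forall i, (i < n + m)%N -> 0 < lam i) ->
     ((\sum_(n <= i < n + m) lam i)%:E <= b)%E) ->
  (\sum_(n <= i <oo) (lam i)%:E <= b)%E.
Proof.
move=> lam0 lam_anti b0 lamb.
have bnd m : ((\sum_(n <= i < n + m) lam i)%:E <= b)%E.
  elim: m => [|m IH]; first by rewrite addn0 big_geq.
  have [lam_gt0|lam_le0] := ltP 0 (lam (n + m)%N).
    apply: lamb => i; rewrite addnS ltnS => im.
    exact: lt_le_trans lam_gt0 (lam_anti _ _ im).
  rewrite addnS big_nat_recr ?leq_addr//=.
  have -> : lam (n + m)%N = 0 by apply/le_anti; rewrite lam_le0 lam0.
  by rewrite addr0.
apply: lime_le; first by apply: is_cvg_nneseries => i _ _; rewrite lee_fin.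
near=> m; have nm : (n <= m)%N by near: m; exact: nbhs_infty_ge.
by rewrite sumEFin -(subnKC nm).
Unshelve. all: by end_near. Qed.

(** * The uniform and the one-sided lower bound *)

Theorem theorem4 (R : realType) (d : nat) (X : set 'rV[R]_d)
  (k : 'rV[R]_d -> 'rV[R]_d -> R)
  (H : set ('rV[R]_d -> R)) (ip : ('rV[R]_d -> R) -> ('rV[R]_d -> R) -> R)
  (rho : probability (BorelE R d) R) (lam : nat -> R)
  (n : nat) (xs : 'I_n -> 'rV[R]_d)
  (G : ('rV[R]_d -> R) -> ('rV[R]_d -> R)) :
  compact X ->
  cont_pd_kernel X k ->
  (forall x, X x -> k x x <= 1) ->
  is_RKHS X k H ip ->
  rho (X : set (BorelE R d)) = 1%E ->
  is_eigseq rho X k lam ->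
  (0 < n)%N ->
  (forall i, X (xs i)) ->
  (forall f, unit_ball H ip f ->
     {within X, continuous (G f)} /\
     exists M : R, forall y, X y -> `|G f y| <= M) ->
  (forall f f', unit_ball H ip f -> unit_ball H ip f' ->
     (forall i, f (xs i) = f' (xs i)) -> forall y, X y -> G f y = G f' y) ->
  ((poweR (\sum_(n <= i <oo) (lam i)%:E) 2^-1 <=
      ereal_sup [set supnorm X (fun y => (f y - G f y)%R) | f in unit_ball H ip])%E
   /\
   ((forall f, unit_ball H ip f -> forall y, X y -> f y <= G f y) ->
    (\sum_(n <= i <oo) (lam i)%:E <=
      ereal_sup [set (\int[rho]_(y in (X : set (BorelE R d))) ((G f y - f y)%R)%:E)%E
                 | f in unit_ball H ip])%E)).
Proof.
move=> cX k_pd k_le1 rk rhoX eig n_gt0 Xxs Gc Gxs.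
have mX := compact_measurable_BorelE R d X cX.
have [lam0 lam_anti _] := eig.
have ip_lin (a : R) (f g h : 'rV[R]_d -> R) : H f -> H g -> H h ->
  ip (a *: f + g) h = a * ip f h + ip g h := @rkhs_lin _ _ _ _ _ _ rk a f g h.
have HZ (a : R) (f : 'rV[R]_d -> R) : H f -> H (a *: f) :=
  @rkhs_scale _ _ _ _ _ _ rk a f.
have ball0 : unit_ball H ip (fun=> 0).
  split; first exact: (rkhs_0 rk).
  by rewrite (ip_0l _ _ _ _ (rkhs_0 rk) ip_lin) ?ler01//; exact: (rkhs_0 rk).
have ballN f : unit_ball H ip f -> unit_ball H ip (- f).
  rewrite -scaleN1r => -[Hf f1]; split; first exact: HZ.
  rewrite (ip_Zr _ _ _ _ (rkhs_0 rk) HZ (@rkhs_sym _ _ _ _ _ _ rk) ip_lin)//;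
    last exact: HZ.
  by rewrite (ip_Zl _ _ _ _ (rkhs_0 rk) ip_lin)// !mulN1r opprK.
have G0E f : unit_ball H ip f -> (forall i, f (xs i) = 0) ->
    forall y, X y -> G f y = G (fun=> 0) y.
  by move=> bf fxs y Xy; apply: Gxs.
have hidden m := residual_function R d X k H ip k_pd k_le1 rk cX rho lam n m xs eig.
split.
  set b := ereal_sup _.
  have b_ge f y : unit_ball H ip f -> X y -> (`|f y - G f y|%:E <= b)%E.
    move=> bf Xy; apply: (@le_trans _ _ (supnorm X (fun y => f y - G f y))).
      by apply: ereal_sup_ubound; exists y.
    by apply: ereal_sup_ubound; exists f.
  (* Mass 1 forces a point in [X], so the supremum [b] is nonnegative. This excludes [-oo], and
     [+oo] is trivial, which leaves a real [b]. *)
  have [x0 Xx0] : X !=set0.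
    apply/set0P/eqP => X0; move: rhoX; rewrite X0 measure0 => /eqP.
    by rewrite eq_sym onee_eq0.
  have b0 : (0 <= b)%E.
    by apply: le_trans (b_ge _ _ ball0 Xx0); rewrite lee_fin.
  case: b b_ge b0 => [b||]// b_ge b0; last by rewrite leey.
  rewrite lee_fin in b0.
  suff sum_le : (\sum_(n <= i <oo) (lam i)%:E <= (b ^+ 2)%:E)%E.
    have sum_ge0 : (0 <= \sum_(n <= i <oo) (lam i)%:E)%E.
      by apply: nneseries_ge0 => i _ _; rewrite lee_fin.
    rewrite poweR12_sqrt//; apply: (@le_trans _ _ (sqrte (b ^+ 2)%:E)).
      by rewrite lee_sqrt ?lee_fin ?sqr_ge0.
    by rewrite /= sqrtr_sqr ger0_norm.
  apply: nneseries_le_of_pos => //; first by rewrite lee_fin sqr_ge0.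
  move=> m lam_gt0; have [q [mq q0 sum_le qf]] := hidden m lam_gt0.
  apply: le_trans sum_le _.
  apply: (@le_trans _ _ (\int[rho]_(y in (X : set (BorelE R d))) (b ^+ 2)%:E)%E); last first.
    by rewrite integral_cst// [X in (_ * X <= _)%E](_ : _ = 1%E) ?mule1//; exact: rhoX.
  apply: ge0_le_integral => //.
  - by move=> y _; rewrite lee_fin.
  - exact/measurable_EFinP.
  (* The values [Num.sqrt (q y)] and its opposite both lie within [b] of the single number
     [G (fun=> 0) y], so half their distance, [Num.sqrt (q y)], is at most [b]. *)
  - move=> y Xy; have [_ [f [bf fxs fy]]] := qf y Xy.
    have bNf := ballN f bf.
    have Nfxs i : (- f) (xs i) = 0 by rewrite -[LHS]/(- (f (xs i))) fxs oppr0.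
    have := b_ge _ _ bf Xy; have := b_ge _ _ bNf Xy.
    rewrite (G0E _ bf fxs y Xy) (G0E _ bNf Nfxs y Xy) !lee_fin !ler_norml.
    rewrite -[(- f) y]/(- (f y)) fy => /andP[b1 b2] /andP[b3 b4].
    by rewrite -[q y]sqr_sqrtr// ler_sqr ?nnegrE ?sqrtr_ge0//; lra.
move=> f_le_G; have [G0c _] := Gc _ ball0.
have G0_ge0 y : X y -> 0 <= G (fun=> 0) y by exact: f_le_G.
(* The zero function alone realises the bound: its one-sided error is the integral of its image,
   which must lie above every [f] vanishing at the nodes. *)
apply: (@le_trans _ _ (\int[rho]_(y in (X : set (BorelE R d))) (G (fun=> 0) y)%:E)%E); last first.
  apply: ereal_sup_ubound; exists (fun=> 0) => //.
  by apply: eq_integral => y _; rewrite subr0.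
apply: nneseries_le_of_pos => //.
  by apply: integral_ge0 => y Xy; rewrite lee_fin G0_ge0.
move=> m lam_gt0; have [q [mq q0 sum_le qf]] := hidden m lam_gt0.
apply: le_trans sum_le _; apply: ge0_le_integral => //.
- by move=> y _; rewrite lee_fin.
- exact/measurable_EFinP.
- by apply/measurable_EFinP; exact: within_continuous_measurable_BorelE.
- move=> y Xy; have [q1 [f [bf fxs fy]]] := qf y Xy.
  rewrite lee_fin -(G0E _ bf fxs y Xy).
  apply: le_trans (f_le_G _ bf _ Xy); rewrite fy.
  have s1 : Num.sqrt (q y) <= 1 by rewrite -sqrtr1 ler_wsqrtr.
  by rewrite -{1}[q y]sqr_sqrtr// expr2 ler_piMr ?sqrtr_ge0.
Qed.
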